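(* There exist a bijection $B_\bullet\colon\mathrm{PsCtx}\to\mathrm{Bat}$, $\Gamma\mapsto B_\Gamma$, from the set of pasting contexts to the set of Batanin trees, together with a family of isomorphisms of globular sets $$R^{\mathrm{Bat}}_\Gamma\colon V\Gamma\xrightarrow{\ \sim\ }\mathrm{Pos}(B_\Gamma)\qquad(\Gamma\in\mathrm{PsCtx}),$$ such that for every pasting context $\Gamma$ with $\dim\Gamma\ge1$, the isomorphism $R^{\mathrm{Bat}}_\Gamma$ sends the image of $V(s^\Gamma_{\dim\Gamma-1})\colon V(\partial^-_{\dim\Gamma-1}\Gamma)\to V\Gamma$ to the image of $s^{B_\Gamma}_{\dim\Gamma-1}\colon\mathrm{Pos}(\partial_{\dim\Gamma-1}B_\Gamma)\to\mathrm{Pos}(B_\Gamma)$, and sends the image of $V(t^\Gamma_{\dim\Gamma-1})\colon V(\partial^+_{\dim\Gamma-1}\Gamma)\to V\Gamma$ to the image of $t^{B_\Gamma}_{\dim\Gamma-1}$.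
   Context: **Pasting contexts.** Here types are expressions $\ast$ or $u\to_A v$ with $A$ a type and $u,v$ variables; contexts $\Gamma$ are finite lists of pairs $(x:A)$ with $x$ a variable and $A$ a type; $\mathrm{Var}(\Gamma)$ is the set of variables listed in $\Gamma$. Dimensions: $\dim\ast=-1$, $\dim(u\to_A v)=\dim A+1$, $\dim\emptyset=-1$, $\dim(\Gamma,x:A)=\max(\dim\Gamma,\dim A+1)$. Judgements $\Gamma\vdash_{ps}x:A$ and $\Gamma\vdash_{ps}$ are generated by the rules: (pss) $(x:\ast)\vdash_{ps}x:\ast$; (psd) from $\Gamma\vdash_{ps}f:x\to_A y$ infer $\Gamma\vdash_{ps}y:A$; (pse) from $\Gamma\vdash_{ps}x:A$ and distinct $y,f\notin\mathrm{Var}(\Gamma)$ infer $\Gamma,y:A,f:x\to_A y\vdash_{ps}f:x\to_A y$; (ps) from $\Gamma\vdash_{ps}x:\ast$ infer $\Gamma\vdash_{ps}$. $\Gamma$ is a pasting context if $\Gamma\vdash_{ps}$ is derivable; derivations are unique. $\mathrm{PsCtx}$ is the set of pasting contexts up to renaming of variables. For $k\in\mathbb N$ and $\epsilon\in\{+,-\}$, the pasting context $\partial^\epsilon_k\Gamma$ is defined by induction on the derivation: (pss) $\partial^\epsilon_k((x:\ast)\vdash_{ps}x:\ast)=(x:\ast)$; (psd) $\partial^\epsilon_k(\Gamma\vdash_{ps}y:A)=\partial^\epsilon_k(\Gamma\vdash_{ps}f:x\to_A y)$; (ps) $\partial^\epsilon_k(\Gamma\vdash_{ps})=\partial^\epsilon_k(\Gamma\vdash_{ps}x:\ast)$;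 (pse) writing $D^\epsilon=\partial^\epsilon_k(\Gamma\vdash_{ps}x:A)$, the value at $\Gamma,y:A,f:x\to_A y\vdash_{ps}f:x\to_A y$ is $D^\epsilon$ if $\dim A+1>k$; $(D^\epsilon,y:A,f:x\to_A y)$ if $\dim A+1\le k-1$; $D^-$ if $\dim A+1=k$, $\epsilon=-$; and $(\mathrm{rm}\,D^+,y:A)$ if $\dim A+1=k$, $\epsilon=+$, where $\mathrm{rm}$ deletes the last entry of a list. The substitutions $s^\Gamma_k$ (from $\Gamma$ to $\partial^-_k\Gamma$) and $t_k^\Gamma$ (from $\Gamma$ to $\partial^+_k\Gamma$) assign to each variable of $\partial^{-}_k\Gamma$, resp. $\partial_k^+\Gamma$, the variable of $\Gamma$ with the same name. **Globular sets.** A globular set $X$ is a family of sets $X_n$ ($n\in\mathbb N$) with functions $\mathrm{src},\mathrm{tgt}\colon X_{n+1}\to X_n$ with $\mathrm{src}\,\mathrm{src}=\mathrm{src}\,\mathrm{tgt}$, $\mathrm{tgt}\,\mathrm{src}=\mathrm{tgt}\,\mathrm{tgt}$; morphisms are families of functions commuting with $\mathrm{src},\mathrm{tgt}$. $\mathbb D^0$ is the globular set with a single cell, of dimension $0$. For a pasting context $\Gamma$, $V\Gamma$ is the globular set whose $n$-cells are the variables $x$ with $(x:A)\in\Gamma$ and $\dim A+1=n$, a variable of type $u\to_A v$ having source $u$ and target $v$. The assignment $V$ is contravariant: $V(s^\Gamma_k)\colon V(\partial^-_k\Gamma)\to V\Gamma$ and $V(t^\Gamma_k)\colon V(\partial^+_k\Gamma)\to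 V\Gamma$ send each variable to the variable of the same name. **Batanin trees.** The set $\mathrm{Bat}$ of Batanin trees is inductively generated by $\mathrm{br}\colon\mathrm{List}(\mathrm{Bat})\to\mathrm{Bat}$. The $k$-boundary is given by $\partial_0B=\mathrm{br}[]$, $\partial_{k+1}\mathrm{br}[B_1,\dots,B_n]=\mathrm{br}[\partial_kB_1,\dots,\partial_kB_n]$. The globular set of positions is $\mathrm{Pos}(\mathrm{br}[B_1,\dots,B_n])=\bigvee_{i=1}^n\Sigma\mathrm{Pos}(B_i)$, where the suspension $\Sigma X$ has two $0$-cells $v_-,v_+$ (its first and second basepoints) and $(\Sigma X)_{n+1}=X_n$ with all $1$-cells going from $v_-$ to $v_+$, and the wedge $X\vee Y$ of bipointed globular sets identifies the second basepoint of $X$ with the first basepoint of $Y$ (and has as basepoints the first of $X$ and the second of $Y$; the empty wedge is $\mathbb D^0$). The maps $s_k^B,t_k^B\colon\mathrm{Pos}(\partial_kB)\to\mathrm{Pos}(B)$ are: $s_0^B,t_0^B\colon\mathbb D^0\to\mathrm{Pos}(B)$ pick the first and second basepoint respectively, and $s_{k+1}^{\mathrm{br}[B_1,\dots,B_n]}=\bigvee_i\Sigma s_k^{B_i}$, $t_{k+1}^{\mathrm{br}[B_1,\dots,B_n]}=\bigvee_i\Sigma t_k^{B_i}$. *)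

(* Defs.v *)
From HB Require Import structures.
From mathcomp Require Import all_boot all_order all_algebra zify.
From mathcomp Require Import classical_sets.

Set Implicit Arguments.
Unset Strict Implicit.
Unset Printing Implicit Defensive.

Import Order.TTheory GRing.Theory Num.Theory.

(* Cells form eqTypes so that the gluing in [wedge] below is computable. *)
Record globSet := GlobSet {
  cell :> nat -> eqType;
  src : forall n, cell n.+1 -> cell n;
  tgt : forall n, cell n.+1 -> cell n;
  src_src : forall n (x : cell n.+2), src (src x) = src (tgt x);
  tgt_src : forall n (x : cell n.+2), tgt (src x) = tgt (tgt x) }.

Record gmap (X Y : globSet) := GMap {
  gfun :> forall n, X n -> Y n;
  gmap_src : forall n (x : X n.+1), gfun (src x) = src (gfun x);
  gmap_tgt : forall n (x : X n.+1), gfun (tgt x) = tgt (gfun x) }.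

Record giso (X Y : globSet) := GIso {
  giso_map :> gmap X Y;
  giso_inv : gmap Y X;
  giso_K : forall n, cancel (@giso_map n) (@giso_inv n);
  giso_VK : forall n, cancel (@giso_inv n) (@giso_map n) }.

Record bigset := BiGset {
  bcar :> globSet;
  pt1 : bcar 0;
  pt2 : bcar 0 }.

Record bmap (X Y : bigset) := BMap {
  bfun :> gmap X Y;
  bmap_pt1 : bfun 0 (pt1 X) = pt1 Y;
  bmap_pt2 : bfun 0 (pt2 X) = pt2 Y }.

Section Disk.

Definition D0_cell (n : nat) : eqType := if n is 0 then unit else void.

Definition D0_bd n : D0_cell n.+1 -> D0_cell n := fun x => match x with end.

Lemma D0_bdbd n (x : D0_cell n.+2) : D0_bd (D0_bd x) = D0_bd (D0_bd x).
Proof. by []. Qed.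

Definition D0_gset : globSet := GlobSet D0_bdbd D0_bdbd.

Definition D0 : bigset := @BiGset D0_gset tt tt.

Definition D0_map_fun (X : globSet) (p : X 0) (n : nat) : D0 n -> X n :=
  match n with 0 => fun=> p | _.+1 => fun x => match x with end end.

Lemma D0_map_src (X : globSet) (p : X 0) n (x : D0 n.+1) :
  D0_map_fun p (src x) = src (D0_map_fun p x).
Proof. by case: x. Qed.

Lemma D0_map_tgt (X : globSet) (p : X 0) n (x : D0 n.+1) :
  D0_map_fun p (tgt x) = tgt (D0_map_fun p x).
Proof. by case: x. Qed.

Definition D0_map (X : globSet) (p : X 0) : gmap D0 X :=
  GMap (D0_map_src p) (D0_map_tgt p).

End Disk.

Section Suspension.

(* The 0-cells are v_- := false and v_+ := true. *)
Definition susp_cell (X : globSet) (n : nat) : eqType :=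
  if n is m.+1 then X m else bool.

Definition susp_src (X : globSet) (n : nat) :
    susp_cell X n.+1 -> susp_cell X n :=
  if n is m.+1 then @src X m else fun=> false.

Definition susp_tgt (X : globSet) (n : nat) :
    susp_cell X n.+1 -> susp_cell X n :=
  if n is m.+1 then @tgt X m else fun=> true.

Lemma susp_src_src X n (x : susp_cell X n.+2) :
  susp_src (susp_src x) = susp_src (susp_tgt x).
Proof. by case: n x => [|n] //= x; exact: src_src. Qed.

Lemma susp_tgt_src X n (x : susp_cell X n.+2) :
  susp_tgt (susp_src x) = susp_tgt (susp_tgt x).
Proof. by case: n x => [|n] //= x; exact: tgt_src. Qed.

Definition susp (X : globSet) : bigset :=
  @BiGset (GlobSet (@susp_src_src X) (@susp_tgt_src X)) false true.

Definition susp_fun (X Y : globSet) (f : gmap X Y) (n : nat) :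
    susp X n -> susp Y n :=
  if n is m.+1 then f m else id.

Lemma susp_fun_src X Y (f : gmap X Y) n (x : susp X n.+1) :
  susp_fun f (src x) = src (susp_fun f x).
Proof. by case: n x => [|n] //= x; exact: gmap_src. Qed.

Lemma susp_fun_tgt X Y (f : gmap X Y) n (x : susp X n.+1) :
  susp_fun f (tgt x) = tgt (susp_fun f x).
Proof. by case: n x => [|n] //= x; exact: gmap_tgt. Qed.

Definition susp_map (X Y : globSet) (f : gmap X Y) : bmap (susp X) (susp Y) :=
  @BMap (susp X) (susp Y) (GMap (susp_fun_src f) (susp_fun_tgt f))
    (erefl _) (erefl _).

End Suspension.

Section Wedge.

(* The pushout of X and Y along pt2 X = pt1 Y: in dimension 0, pt1 Y is
   removed from Y and represented by pt2 X. *)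
Definition wedge_cell (X Y : bigset) (n : nat) : eqType :=
  if n is m.+1 then (X m.+1 + Y m.+1)%type
  else (X 0 + {y : Y 0 | y != pt1 Y})%type.

Definition wedge_inl (X Y : bigset) (n : nat) : X n -> wedge_cell X Y n :=
  if n is m.+1 then inl else inl.

Definition wedge_inr0 (X Y : bigset) (y : Y 0) : wedge_cell X Y 0 :=
  if insub y is Some y' then inr y' else inl (pt2 X).

Definition wedge_inr (X Y : bigset) (n : nat) : Y n -> wedge_cell X Y n :=
  if n is m.+1 then inr else @wedge_inr0 X Y.

Definition wedge_src (X Y : bigset) (n : nat) (c : wedge_cell X Y n.+1) :
    wedge_cell X Y n :=
  match c with
  | inl x => wedge_inl Y (src x)
  | inr y => wedge_inr X (src y)
  end.

Definition wedge_tgt (X Y : bigset) (n : nat) (c : wedge_cell X Y n.+1) :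
    wedge_cell X Y n :=
  match c with
  | inl x => wedge_inl Y (tgt x)
  | inr y => wedge_inr X (tgt y)
  end.

Lemma wedge_src_src X Y n (c : wedge_cell X Y n.+2) :
  wedge_src (wedge_src c) = wedge_src (wedge_tgt c).
Proof. by case: c => x /=; rewrite src_src. Qed.

Lemma wedge_tgt_src X Y n (c : wedge_cell X Y n.+2) :
  wedge_tgt (wedge_src c) = wedge_tgt (wedge_tgt c).
Proof. by case: c => x /=; rewrite tgt_src. Qed.

Definition wedge (X Y : bigset) : bigset :=
  @BiGset (GlobSet (@wedge_src_src X Y) (@wedge_tgt_src X Y))
    (wedge_inl Y (pt1 X)) (wedge_inr X (pt2 Y)).

Variables (X X' Y Y' : bigset) (f : bmap X X') (g : bmap Y Y').

Definition wedge_fun (n : nat) : wedge X Y n -> wedge X' Y' n :=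
  match n with
  | 0 => fun c => match c with
                  | inl x => wedge_inl Y' (f 0 x)
                  | inr y => wedge_inr X' (g 0 (val y))
                  end
  | m.+1 => fun c => match c with
                     | inl x => inl (f m.+1 x)
                     | inr y => inr (g m.+1 y)
                     end
  end.

Lemma wedge_fun_inl n (x : X n) :
  wedge_fun (wedge_inl Y x) = wedge_inl Y' (f n x).
Proof. by case: n x. Qed.

Lemma wedge_fun_inr n (y : Y n) :
  wedge_fun (wedge_inr X y) = wedge_inr X' (g n y).
Proof.
case: n y => [|n] //= y; rewrite {1}/wedge_inr0.
case: insubP => [u _ -> //|]; rewrite negbK => /eqP ->.
by rewrite !bmap_pt1 bmap_pt2 /wedge_inr0 insubF // eqxx.
Qed.

Lemma wedge_fun_src n (c : wedge X Y n.+1) :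
  wedge_fun (src c) = src (wedge_fun c).
Proof.
by case: c => x /=; rewrite ?wedge_fun_inl ?wedge_fun_inr gmap_src.
Qed.

Lemma wedge_fun_tgt n (c : wedge X Y n.+1) :
  wedge_fun (tgt c) = tgt (wedge_fun c).
Proof.
by case: c => x /=; rewrite ?wedge_fun_inl ?wedge_fun_inr gmap_tgt.
Qed.

Lemma wedge_fun_pt1 : wedge_fun (pt1 (wedge X Y)) = pt1 (wedge X' Y').
Proof. by rewrite /= bmap_pt1. Qed.

Lemma wedge_fun_pt2 : wedge_fun (pt2 (wedge X Y)) = pt2 (wedge X' Y').
Proof. by rewrite [LHS](wedge_fun_inr (pt2 Y)) bmap_pt2. Qed.

Definition wedge_map : bmap (wedge X Y) (wedge X' Y') :=
  @BMap (wedge X Y) (wedge X' Y') (GMap wedge_fun_src wedge_fun_tgt)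
    wedge_fun_pt1 wedge_fun_pt2.

End Wedge.

Definition bigwedge (Xs : seq bigset) : bigset := foldr wedge D0 Xs.

Definition bmap_id (X : bigset) : bmap X X :=
  @BMap X X (@GMap X X (fun=> id) (fun _ _ => erefl) (fun _ _ => erefl))
    (erefl _) (erefl _).

Inductive Bat : Type := br of seq Bat.

Fixpoint bat_bd (k : nat) (B : Bat) : Bat :=
  match k, B with
  | 0, _ => br [::]
  | k'.+1, br Bs => br [seq bat_bd k' B' | B' <- Bs]
  end.

Fixpoint Pos (B : Bat) : bigset :=
  match B with br Bs => bigwedge [seq susp (Pos B') | B' <- Bs] end.

Fixpoint bigwedge_susp_map (h : Bat -> Bat)
    (f : forall B, gmap (Pos (h B)) (Pos B)) (Bs : seq Bat) :
    bmap (Pos (br [seq h B | B <- Bs])) (Pos (br Bs)) :=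
  match Bs with
  | [::] => bmap_id D0
  | B :: Bs' => wedge_map (susp_map (f B)) (bigwedge_susp_map f Bs')
  end.

Fixpoint pos_s (k : nat) : forall B, gmap (Pos (bat_bd k B)) (Pos B) :=
  match k with
  | 0 => fun B => D0_map (pt1 (Pos B))
  | k'.+1 => fun B => match B with br Bs => bigwedge_susp_map (pos_s k') Bs end
  end.

Fixpoint pos_t (k : nat) : forall B, gmap (Pos (bat_bd k B)) (Pos B) :=
  match k with
  | 0 => fun B => D0_map (pt2 (Pos B))
  | k'.+1 => fun B => match B with br Bs => bigwedge_susp_map (pos_t k') Bs end
  end.

Definition var := nat.

(* [Arr u A v] is u ->_A v *)
Inductive ty : Type := Star | Arr of var & ty & var.

Fixpoint ty_eqb (A B : ty) : bool :=
  match A, B with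
  | Star, Star => true
  | Arr u A v, Arr u' A' v' => [&& u == u', ty_eqb A A' & v == v']
  | _, _ => false
  end.

Lemma ty_eqP : Equality.axiom ty_eqb.
Proof.
elim=> [|u A IH v] [|u' A' v'] /=; try by constructor.
apply: (iffP and3P) => [[/eqP -> /IH -> /eqP ->] //|[-> <- ->]].
by split=> //; apply/IH.
Qed.

HB.instance Definition _ := hasDecEq.Build ty ty_eqP.

(* Contexts are listed from right to left: (x, A) :: Γ is (Γ, x : A). *)
Definition ctx := seq (var * ty).

Definition Var (Γ : ctx) : seq var := [seq p.1 | p <- Γ].

Fixpoint ty_dim (A : ty) : int :=
  if A is Arr _ A' _ then (ty_dim A' + 1)%R else (-1)%R.

Fixpoint ctx_dim (Γ : ctx) : int :=
  if Γ is (_, A) :: Γ' then Num.max (ctx_dim Γ') (ty_dim A + 1)%R else (-1)%R.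

Inductive psv : ctx -> var -> ty -> Type :=
| pss x : psv [:: (x, Star)] x Star
| psd Γ f x A y : psv Γ f (Arr x A y) -> psv Γ y A
| pse Γ x A y f : psv Γ x A ->
    y \notin Var Γ -> f \notin Var Γ -> y != f ->
    psv ((f, Arr x A y) :: (y, A) :: Γ) f (Arr x A y).

Inductive ps (Γ : ctx) : Type := ps_intro x of psv Γ x Star.

Record pctx := PCtx { ctx_of :> ctx; ps_of : ps ctx_of }.

Lemma ty_dim_ge A : (-1 <= ty_dim A)%R.
Proof. by elim: A => //= u A IH v; lia. Qed.

Lemma psv_mem Γ x A : psv Γ x A ->
  (x, A) \in Γ /\
  forall z u B v, (z, Arr u B v) \in Γ -> (u, B) \in Γ /\ (v, B) \in Γ.
Proof.
elim=> {Γ x A} [x|Γ f x A y _ [fΓ clΓ]|Γ x A y f _ [xΓ clΓ] yΓ fΓ yf].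
- split=> [|z u B v]; rewrite !inE ?eqxx //.
  by case/eqP.
- by split=> //; case: (clΓ _ _ _ _ fΓ).
split=> [|z u B v]; first by rewrite inE eqxx.
rewrite !inE => /or3P [/eqP [_ -> -> ->]|/eqP [_ eA]|zΓ].
- by rewrite xΓ eqxx !orbT.
- by move: xΓ; rewrite -eA => /clΓ [-> ->]; rewrite !orbT.
by case: (clΓ _ _ _ _ zΓ) => -> ->; rewrite !orbT.
Qed.

Lemma psv_uniq Γ x A : psv Γ x A -> uniq (Var Γ).
Proof.
elim=> //= {}Γ {}x {}A y f _ -> yΓ fΓ yf.
by rewrite inE eq_sym negb_or yf fΓ yΓ.
Qed.

Lemma ps_uniq (Γ : pctx) : uniq (Var Γ).
Proof. by case: Γ => Γ [x d]; exact: psv_uniq d. Qed.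

Section V.
Variable Γ : pctx.

(* An n-cell is a declaration (x : A) of Γ with dim A + 1 = n.  By [ps_uniq]
   it is determined by the variable x. *)
Definition V_cell (n : nat) : eqType :=
  {p : var * ty | (p \in ctx_of Γ) && (ty_dim p.2 + 1 == n%:Z)%R}.

(* The values at Star are junk: such a variable is a 0-cell. *)
Definition decl_src (p : var * ty) : var * ty :=
  if p.2 is Arr u A v then (u, A) else p.

Definition decl_tgt (p : var * ty) : var * ty :=
  if p.2 is Arr u A v then (v, A) else p.

Lemma V_src_subproof n (c : V_cell n.+1) :
  (decl_src (val c) \in ctx_of Γ) && (ty_dim (decl_src (val c)).2 + 1 == n%:Z)%R.
Proof.
case: c => -[x [|u A v]] /= /andP [xΓ /eqP dx]; first by lia.
have [y /psv_mem [_ cl]] := ps_of Γ.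
by rewrite /decl_src /=; case: (cl _ _ _ _ xΓ) => -> _ /=; lia.
Qed.

Lemma V_tgt_subproof n (c : V_cell n.+1) :
  (decl_tgt (val c) \in ctx_of Γ) && (ty_dim (decl_tgt (val c)).2 + 1 == n%:Z)%R.
Proof.
case: c => -[x [|u A v]] /= /andP [xΓ /eqP dx]; first by lia.
have [y /psv_mem [_ cl]] := ps_of Γ.
by rewrite /decl_tgt /=; case: (cl _ _ _ _ xΓ) => _ -> /=; lia.
Qed.

Definition V_src n (c : V_cell n.+1) : V_cell n :=
  exist _ (decl_src (val c)) (V_src_subproof c).

Definition V_tgt n (c : V_cell n.+1) : V_cell n :=
  exist _ (decl_tgt (val c)) (V_tgt_subproof c).

Lemma V_src_src n (c : V_cell n.+2) : V_src (V_src c) = V_src (V_tgt c).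
Proof.
apply: val_inj; case: c => -[x [|u [|u' A v'] v]] //= /andP [_ dx]; lia.
Qed.

Lemma V_tgt_src n (c : V_cell n.+2) : V_tgt (V_src c) = V_tgt (V_tgt c).
Proof.
apply: val_inj; case: c => -[x [|u [|u' A v'] v]] //= /andP [_ dx]; lia.
Qed.

Definition V : globSet := GlobSet V_src_src V_tgt_src.

Definition cell_var n (c : V n) : var := (val c).1.

End V.

Arguments cell_var {Γ n}.

Inductive sign := minus | plus.

Fixpoint psv_bd (e : sign) (k : nat) Γ x A (d : psv Γ x A) : ctx :=
  match d with
  | pss x => [:: (x, Star)]
  | psd Γ f x A y d' => psv_bd e k d'
  | pse Γ x A y f d' _ _ _ =>
      let D := psv_bd e k d' in
      if (k%:Z < ty_dim A + 1)%R then D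
      else if (ty_dim A + 1 <= k%:Z - 1)%R then (f, Arr x A y) :: (y, A) :: D
      else match e with
           | minus => D
           | plus => (y, A) :: behead D
           end
  end.

Definition ps_bd (e : sign) (k : nat) Γ (d : ps Γ) : ctx :=
  match d with ps_intro _ d' => psv_bd e k d' end.

Lemma psv_bd_sub e k Γ x A (d : psv Γ x A) : {subset psv_bd e k d <= Γ}.
Proof.
elim: d => [? ? //|//|{}Γ {}x {}A y f {}d IH _ _ _ p] /=.
case: ifP => _; first by move=> /IH; rewrite !inE => ->; rewrite !orbT.
case: ifP => _.
  by rewrite !inE => /or3P [->|->|/IH ->]; rewrite ?orbT.
case: e IH => IH; first by move=> /IH; rewrite !inE => ->; rewrite !orbT.
rewrite !inE => /orP [->|/mem_behead /IH ->]; by rewrite ?orbT.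
Qed.

Lemma psv_bd_fresh e k Γ x A (d : psv Γ x A) y :
  y \notin Var Γ -> y \notin Var (psv_bd e k d).
Proof.
by apply: contra => /mapP [p pD ->]; apply: map_f; exact: psv_bd_sub pD.
Qed.

(* The iterated target of (x : A), in dimension at most k. *)
Fixpoint ktgt (k : nat) (x : var) (A : ty) : var * ty :=
  if (ty_dim A + 1 <= k%:Z)%R then (x, A)
  else if A is Arr u B v then ktgt k v B else (x, A).

Lemma ktgt_star k x : ktgt k x Star = (x, Star).
Proof. by []. Qed.

Lemma ktgt_small k x A : (ty_dim A + 1 <= k%:Z)%R -> ktgt k x A = (x, A).
Proof. by case: A => [|u B v] //= ->. Qed.

Lemma ktgt_big k x u B v :
  (k%:Z < ty_dim B + 2)%R -> ktgt k x (Arr u B v) = ktgt k v B.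
Proof. by move=> h /=; rewrite ifF //; lia. Qed.

Lemma ktgt_indep k x y A :
  (k%:Z < ty_dim A + 1)%R -> ktgt k x A = ktgt k y A.
Proof. by case: A => [|u B v] //= h; rewrite !ifF //; lia. Qed.

(* D ends with z, and its last entry may be replaced by another variable. *)
Inductive psv_last (D : ctx) (z : var) : ty -> Type :=
| psv_last0 of D = [:: (z, Star)] : psv_last D z Star
| psv_lastS D' u B v of psv D' u B & v \notin Var D' & z \notin Var D'
    & v != z & D = (z, Arr u B v) :: (v, B) :: D' : psv_last D z (Arr u B v).

Lemma psv_last_psv D z A : psv_last D z A -> psv D z A.
Proof.
case=> [->|D' u B v d vD zD vz ->]; first exact: pss.
exact: pse.
Qed.

Lemma psv_last_subst D z A y :
  psv_last D z A -> y \notin Var D -> psv_last ((y, A) :: behead D) y A.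
Proof.
case=> [-> _|D' u B v d vD zD vz -> /=]; first exact: psv_last0.
rewrite !inE !negb_or => /and3P [yz yv yD].
by apply: (psv_lastS d) => //; rewrite eq_sym.
Qed.

Lemma psv_bd_minus k Γ x A (d : psv Γ x A) :
  {z : var & ((ty_dim A + 1 < k%:Z)%R -> z = x)
           & psv (psv_bd minus k d) z (ktgt k x A).2}.
Proof.
elim: d => {Γ x A} [x|Γ f x A y d|Γ x A y f d].
- by exists x => //; exact: pss.
- move=> [z zE dz].
  case: (ltP (ty_dim A + 1)%R k%:Z%R) => hA.
    exists y => //; rewrite ktgt_small /=; last by lia.
    rewrite ktgt_small /= in dz; last by lia.
    exact: psd dz.
  exists z; first by lia.
  by rewrite ktgt_big in dz; last by lia.
move=> [z zE dz] yΓ fΓ yf /=.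
have dA := ty_dim_ge A.
case: ifP => h1.
  exists z; first by lia.
  rewrite ifF; last by lia.
  by rewrite (ktgt_indep y x).
case: ifP => h2.
  rewrite ifT; last by lia.
  exists f => //=.
  move: dz; rewrite zE; last by lia.
  rewrite ktgt_small /=; last by lia.
  by move=> dz; apply: pse => //; exact: psv_bd_fresh.
rewrite ifF; last by lia.
exists z; first by lia.
rewrite ktgt_small /=; last by lia.
by rewrite ktgt_small /= in dz; last by lia.
Qed.

Lemma psv_bd_plus k Γ x A (d : psv Γ x A) :
  (((k%:Z <= ty_dim A + 1)%R ->
     psv_last (psv_bd plus k d) (ktgt k x A).1 (ktgt k x A).2) *
   psv (psv_bd plus k d) (ktgt k x A).1 (ktgt k x A).2)%type.
Proof.
elim: d => {Γ x A} [x|Γ f x A y d|Γ x A y f d].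
- by split=> [_|]; [exact: psv_last0|exact: pss].
- move=> [lz dz].
  case: (ltP (ty_dim A + 1)%R k%:Z%R) => hA.
    split; first by lia.
    rewrite ktgt_small /=; last by lia.
    rewrite ktgt_small /= in dz; last by lia.
    exact: psd dz.
  by rewrite ktgt_big in lz dz; last lia; split=> // _; apply: lz => /=; lia.
move=> [lz dz] yΓ fΓ yf /=.
have dA := ty_dim_ge A.
case: ifP => h1.
  rewrite ifF; last by lia.
  rewrite (ktgt_indep y x) //.
  by split=> // _; apply: lz; lia.
rewrite ktgt_small /= in lz dz; last by lia.
case: ifP => h2.
  rewrite ifT; last by lia.
  split=> [_|]; last by apply: pse => //; exact: psv_bd_fresh.
  by apply: (psv_lastS dz) => //; exact: psv_bd_fresh.
rewrite ifF; last by lia.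
rewrite ktgt_small /=; last by lia.
have ly : psv_last ((y, A) :: behead (psv_bd plus k d)) y A.
  by apply: (@psv_last_subst _ x); [apply: lz; lia|exact: psv_bd_fresh].
by split=> // ; exact: psv_last_psv ly.
Qed.

Lemma ps_bd_ps e k Γ (d : ps Γ) : ps (ps_bd e k d).
Proof.
case: d => x d; case: e.
  by have [z _] := psv_bd_minus k d; rewrite ktgt_star => dz; exists z.
by have [_] := psv_bd_plus k d; rewrite ktgt_star => dz; exists x.
Qed.

Definition pctx_bd (e : sign) (k : nat) (Γ : pctx) : pctx :=
  PCtx (ps_bd_ps e k (ps_of Γ)).

Section VBd.
Variables (e : sign) (k : nat) (Γ : pctx).

Lemma pctx_bd_sub : {subset ctx_of (pctx_bd e k Γ) <= ctx_of Γ}.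
Proof. by case: Γ => G [x d] p /=; exact: psv_bd_sub. Qed.

Lemma V_bd_subproof n (c : V (pctx_bd e k Γ) n) :
  (val c \in ctx_of Γ) && (ty_dim (val c).2 + 1 == n%:Z)%R.
Proof. by case: c => p /= /andP [/pctx_bd_sub -> ->]. Qed.

Definition V_bd_fun n (c : V (pctx_bd e k Γ) n) : V Γ n :=
  exist _ (val c) (V_bd_subproof c).

Lemma V_bd_src n (c : V (pctx_bd e k Γ) n.+1) :
  V_bd_fun (src c) = src (V_bd_fun c).
Proof. exact: val_inj. Qed.

Lemma V_bd_tgt n (c : V (pctx_bd e k Γ) n.+1) :
  V_bd_fun (tgt c) = tgt (V_bd_fun c).
Proof. exact: val_inj. Qed.

Definition V_bd : gmap (V (pctx_bd e k Γ)) (V Γ) := GMap V_bd_src V_bd_tgt.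

End VBd.

Definition V_s (k : nat) (Γ : pctx) : gmap (V (pctx_bd minus k Γ)) (V Γ) :=
  V_bd minus k Γ.

Definition V_t (k : nat) (Γ : pctx) : gmap (V (pctx_bd plus k Γ)) (V Γ) :=
  V_bd plus k Γ.

Fixpoint ty_ren (σ : var -> var) (A : ty) : ty :=
  if A is Arr u A' v then Arr (σ u) (ty_ren σ A') (σ v) else Star.

Definition ctx_ren (σ : var -> var) (Γ : ctx) : ctx :=
  [seq (σ p.1, ty_ren σ p.2) | p <- Γ].

Definition renaming (σ : var -> var) (Γ Δ : ctx) : Prop :=
  {in Var Γ &, injective σ} /\ Δ = ctx_ren σ Γ.

Definition ren_class (Γ : pctx) : set pctx :=
  [set Δ : pctx | exists σ, renaming σ Γ Δ]%classic.

Definition PsCtx : Type := {c : set pctx | exists Γ, c = ren_class Γ}.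

Definition represents (Γ : pctx) (c : PsCtx) : Prop := sval c Γ.

(* Main.v *)
Require Import Defs.
From mathcomp Require Import all_boot all_order all_algebra.
From mathcomp Require Import classical_sets.
From mathcomp Require Import boolp zify.

(* A pasting context is determined up to renaming by the sequence of dimensions
   of its declarations, which is the preorder depth sequence of a unique tree.
   Conversely, traversing a tree B in preorder extends any Γ ⊢ x : A by
   declarations labelled by the positions of B.  Labellings from a canonical
   context make the isomorphism independent of names, because a renaming is
   determined on the variables of its source.  Finally, in both V Γ and Pos B
   the image of the k-th source consists of the cells of dimension < k and the
   k-cells that are not the target of a (k+1)-cell (dually for the k-th target),
   a description that every isomorphism preserves. *)

Set Implicit Arguments.
Unset Strict Implicit.
Unset Printing Implicit Defensive.

(** * Trees and their depth sequences *)

(** Peeling off the first branch matches the [foldr] by which [Pos] wedges the branches together. *)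
Lemma Bat_nested_ind (P : Bat -> Prop) :
  P (br [::]) -> (forall B Bs, P B -> P (br Bs) -> P (br (B :: Bs))) ->
  forall B, P B.
Proof.
move=> P0 PS; fix IH 1; case; elim=> [//|B Bs IHBs].
by apply: PS => //; exact: IH.
Qed.

Fixpoint ty_depth (A : ty) : nat :=
  if A is Arr _ A' _ then (ty_depth A').+1 else 0.

Lemma ty_dimE A : (ty_dim A + 1)%R = Posz (ty_depth A).
Proof. by elim: A => //= u A IH v; lia. Qed.

(** Contexts are stored last declaration first, so [rev] is needed to obtain the preorder. *)
Definition dims (Γ : ctx) : seq nat := [seq ty_depth p.2 | p <- Γ].

Lemma ty_depth_ren σ A : ty_depth (ty_ren σ A) = ty_depth A.
Proof. by elim: A => //= u A -> v. Qed.

Lemma dims_ren σ Γ : dims (ctx_ren σ Γ) = dims Γ.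
Proof.
by rewrite /dims /ctx_ren -map_comp; apply: eq_map => p /=; rewrite ty_depth_ren.
Qed.

(* Each branch declares y : A and f : x ->_A y, of dimensions d and d+1, and then
   its own subtree on top of f. *)
Fixpoint tree_dims (d : nat) (B : Bat) : seq nat :=
  let: br Bs := B in
  flatten [seq d :: d.+1 :: tree_dims d.+1 B' | B' <- Bs].

(** Entries of the tree are at least d+1, so it ends at the first entry below that. The default [0]
    of [head] lets an empty remainder qualify. *)
Lemma tree_dims_cat_inj B B' d s s' :
  head 0 s < d.+1 -> head 0 s' < d.+1 ->
  tree_dims d.+1 B ++ s = tree_dims d.+1 B' ++ s' -> B = B' /\ s = s'.
Proof.
elim/Bat_nested_ind: B B' d s s' => [|B Bs IHB IHBs] [[|B' Bs']] d s s' hs hs' //=.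
- by move=> e; move: hs; rewrite e /= ltnn.
- by move=> e; move: hs'; rewrite -e /= ltnn.
have stop Cs t : head 0 t < d.+1 -> head 0 (tree_dims d.+1 (br Cs) ++ t) < d.+2.
  by case: Cs => //=; exact: ltnW.
rewrite -!catA => -[] /IHB [||-> e]; try exact: stop.
by have [|||[->] ->] := IHBs (br Bs') d s s'.
Qed.

Lemma tree_dims_inj B B' : tree_dims 0 B = tree_dims 0 B' -> B = B'.
Proof.
(* At base depth 0 the default of [head] would not lie below the tree, hence the shift to 1. *)
move=> e; suff: tree_dims 1 B = tree_dims 1 B'.
  by move=> e1; case: (@tree_dims_cat_inj B B' 0 [::] [::]) => //; rewrite !cats0.
have shift C d : tree_dims d.+1 C = [seq n.+1 | n <- tree_dims d C].
  elim/Bat_nested_ind: C d => //= C Cs IHC IHCs d.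
  by rewrite map_cat -IHC -(IHCs d).
by rewrite !shift e.
Qed.

(* The rightmost path of B has length at least h, so that B can be grown by a new
   last branch at depth h. *)
Fixpoint spine_ge (h : nat) (B : Bat) : Prop :=
  if h is h'.+1 then
    let: br Bs := B in exists Bs' B', Bs = rcons Bs' B' /\ spine_ge h' B'
  else True.

Lemma spine_geW h B : spine_ge h.+1 B -> spine_ge h B.
Proof.
elim: h B => //= h IH [Bs] [Bs' [B' [-> sB']]].
by exists Bs', B'; split=> //; apply: IH.
Qed.

(** A leaf hung at depth h on the rightmost path comes last in preorder, and it prolongs that path
    to h+1. *)
Lemma grow_tree h B : spine_ge h B -> exists2 B', spine_ge h.+1 B' &
  forall d, tree_dims d B' = tree_dims d B ++ [:: d + h; (d + h).+1].
Proof.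
elim: h B => [|h IH] [Bs] /=.
  move=> _; exists (br (rcons Bs (br [::]))); first by exists Bs, (br [::]).
  by move=> d; rewrite /= map_rcons flatten_rcons addn0.
move=> [Bs' [B' [-> /IH [C sC dC]]]]; exists (br (rcons Bs' C)).
  by exists Bs', C.
by move=> d; rewrite /= !map_rcons !flatten_rcons dC /= -!catA addSnnS.
Qed.

(** The current dimension is a height on the rightmost path: [pse] grows a branch there, [psd] steps
    down by one. The leading 0 is the variable of [pss]. *)
Lemma psv_tree Γ x A (d : psv Γ x A) :
  exists2 B, rev (dims Γ) = 0 :: tree_dims 0 B & spine_ge (ty_depth A) B.
Proof.
elim: d => {Γ x A} [x|Γ f x A y _ [B eB sB]|Γ x A y f _ [B eB sB] _ _ _].
- by exists (br [::]).
- by exists B => //; exact: spine_geW sB.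
have [C sC dC] := grow_tree sB; exists C => //=.
by rewrite !rev_cons eB dC -!cats1 -catA.
Qed.

(** * Dimensions determine a context up to renaming *)

Lemma psv_depth_le Γ x A : psv Γ x A -> ty_depth A <= head 0 (dims Γ).
Proof. by elim=> //= *; exact: ltnW. Qed.

Lemma ty_ren_eq_in Γ x A (d : psv Γ x A) σ τ z B :
  {in Var Γ, σ =1 τ} -> (z, B) \in Γ -> ty_ren σ B = ty_ren τ B.
Proof.
have [_ cl] := psv_mem d => στ.
elim: B z => //= u B IH v z /cl [uΓ vΓ].
rewrite (IH _ uΓ) !στ //; [exact: (map_f fst vΓ)|exact: (map_f fst uΓ)].
Qed.

Lemma ctx_ren_eq_in Γ x A (d : psv Γ x A) σ τ :
  {in Var Γ, σ =1 τ} -> ctx_ren σ Γ = ctx_ren τ Γ.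
Proof.
move=> στ; apply/eq_in_map => -[z B] zΓ /=.
by rewrite (ty_ren_eq_in d στ zΓ) στ //; exact: (map_f fst zΓ).
Qed.

(** The last rule is [psd] exactly when the current dimension lies below that of the last
    declaration. Both derivations therefore use the same rules, and each [pse] extends the renaming
    by two variables. *)
Lemma psv_renaming Γ x A (d : psv Γ x A) Δ x' A' (d' : psv Δ x' A') :
  dims Γ = dims Δ -> ty_depth A = ty_depth A' ->
  exists σ, [/\ renaming σ Γ Δ, σ x = x' & ty_ren σ A = A'].
Proof.
elim: d Δ x' A' d' => {Γ x A}
  [x|Γ f x A y d IH|Γ x A y f d IH yΓ fΓ yf] Δ x' A' d'.
- case: d' => {Δ x' A'} [x'|Δ f' x' A' y' d'|Δ x' A' y' f' d' _ _ _] //.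
  + move=> _ _; exists (fun=> x'); split=> //; split=> // u v.
    by rewrite !inE => /eqP -> /eqP ->.
  + by move=> e; move: (psv_depth_le d'); rewrite -e.
- move: (psv_depth_le d).
  case: d' => {Δ x' A'} [x'|Δ f' x' A' y' d'|Δ x' A' y' f' d' _ _ _] /=.
  + by move=> /[swap] ->.
  + move=> _ eΓ eA; have [|σ [? ? [? ? ?]]] := IH _ _ _ d' eΓ; first by rewrite /= eA.
    by exists σ.
  + by move=> /[swap] -> /= /[swap] ->; rewrite ltnn.
case: d' => {Δ x' A'} [x'|Δ f' x' A' y' d'|Δ x' A' y' f' d' yΔ fΔ yf'] /=.
- by [].
- by move: (psv_depth_le d') => /= /[swap] <- /= /[swap] <-; rewrite ltnn.
move=> [eA _ eΓ] _; have [σ [[σI eΔ] σx σA]] := IH _ _ _ d' eΓ eA.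
pose τ z := if z == y then y' else if z == f then f' else σ z.
have τσ : {in Var Γ, τ =1 σ}.
  move=> z zΓ; rewrite /τ; case: eqP => [zy|_]; first by rewrite -zy zΓ in yΓ.
  by case: eqP => // zf; rewrite -zf zΓ in fΓ.
have [xΓ _] := psv_mem d; have xV : x \in Var Γ := map_f fst xΓ.
have τf : τ f = f' by rewrite /τ eq_sym (negbTE yf) eqxx.
have τy : τ y = y' by rewrite /τ eqxx.
have τA : ty_ren τ A = A' by rewrite (ty_ren_eq_in d τσ xΓ).
have τx : τ x = x' by rewrite τσ.
exists τ; split=> //=; rewrite ?τA ?τx ?τy //; split; last first.
  by rewrite /ctx_ren /= τA τx τy τf -/(ctx_ren τ Γ) (ctx_ren_eq_in d τσ) -eΔ.
have VΔ z : z \in Var Γ -> σ z \in Var Δ.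
  by case/mapP=> -[w B] wΓ ->; rewrite eΔ /Var -map_comp; apply/mapP; exists (w, B).
(* Injectivity of [τ] across old and new variables rests on the freshness of [y'] and [f'] in Δ. *)
have fresh z : z \in Var Γ -> (σ z == y' = false) * (σ z == f' = false).
  move=> /VΔ zΔ; split; apply/eqP => e; first by rewrite -e zΔ in yΔ.
  by rewrite -e zΔ in fΔ.
move=> u v; rewrite !inE.
case/or3P=> [/eqP ->|/eqP ->|uΓ] /or3P [/eqP ->|/eqP ->|vΓ] //;
  rewrite ?τf ?τy ?τσ // => e.
- by rewrite e eqxx in yf'.
- by move: (fresh _ vΓ).2; rewrite -e eqxx.
- by rewrite e eqxx in yf'.
- by move: (fresh _ vΓ).1; rewrite -e eqxx.
- by move: (fresh _ uΓ).2; rewrite e eqxx.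
- by move: (fresh _ uΓ).1; rewrite e eqxx.
- exact: σI.
Qed.

Lemma renamingP (Γ Δ : pctx) : (exists σ, renaming σ Γ Δ) <-> dims Γ = dims Δ.
Proof.
split=> [[σ [_ ->]]|]; first by rewrite dims_ren.
case: Γ Δ => Γ [x d] [Δ [x' d']] /= e.
by have [σ []] := psv_renaming d d' e (erefl _); exists σ.
Qed.

Lemma decl_var_inj (Γ : pctx) p q :
  p \in ctx_of Γ -> q \in ctx_of Γ -> p.1 = q.1 -> p = q.
Proof.
move=> pΓ qΓ e; have u := ps_uniq Γ.
suff : forall s : ctx, uniq (Var s) -> p \in s -> q \in s -> p = q by apply; eauto.
elim=> //= r s IH /andP [rs us]; rewrite !inE.
case/orP=> [/eqP pr|ps] /orP [/eqP qr|qs]; first by rewrite pr qr.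
- by rewrite -pr e map_f in rs.
- by rewrite -qr -e map_f in rs.
exact: IH.
Qed.

(** * Labelling positions by declarations *)

Definition label (X : globSet) := forall n, X n -> var * ty.

(* [G] lists the declarations above (x : A), itself included, that are named by
   the cells of [X]; 0-cells are parallel to x. *)
Record labelling (X : bigset) (G : pred (var * ty)) (A : ty) (x x' : var)
    (l : label X) : Prop := Labelling {
  label_inj : forall n, injective (l n);
  label_mem : forall n c, G (l n c);
  label_depth : forall n c, ty_depth (l n c).2 = ty_depth A + n;
  label_surj : forall r, G r -> exists n c, l n c = r;
  label_src : forall n (c : X n.+1), l n (src c) = decl_src (l n.+1 c);
  label_tgt : forall n (c : X n.+1), l n (tgt c) = decl_tgt (l n.+1 c);
  label_ty0 : forall c, (l 0 c).2 = A;
  label_pt1 : l 0 (pt1 X) = (x, A);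
  label_pt2 : l 0 (pt2 X) = (x', A) }.

Lemma D0_labelling A x : exists l, labelling (X := D0) (pred1 (x, A)) A x x l.
Proof.
exists (fun _ _ => (x, A)); split=> //=.
- by move=> n c d _; case: n c d => [|n] [] // [].
- by case=> [|n] c; [rewrite addn0|case: c].
- by move=> r /eqP ->; exists 0, tt.
Qed.

(** Former 0-cells have type [Arr x A y], so the new points v_- and v_+ must be named x and y. *)
Lemma susp_labelling (X : bigset) (G : pred (var * ty)) A x y f f'
    (l : label X) : x != y ->
  labelling G (Arr x A y) f f' l ->
  exists l', labelling (X := susp X) (predU G (pred2 (x, A) (y, A))) A x y l'.
Proof.
move=> xy L.
exists (fun n => match n return susp X n -> var * ty with
          | 0 => fun b => if b then (y, A) else (x, A)
          | m.+1 => @l m end).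
split=> //=.
- case=> [[] []|n] //=; last exact: label_inj L n.
    by case=> e; rewrite e eqxx in xy.
  by case=> e; rewrite e eqxx in xy.
- case=> [[]|n c] /=; rewrite ?eqxx ?orbT //.
  by rewrite (label_mem L).
- case=> [[]|n c] /=; rewrite ?addn0 //.
  by rewrite (label_depth L) /= addSnnS.
- move=> r /orP [/(label_surj L) [n [c <-]]|/orP [] /eqP ->].
  + by exists n.+1, c.
  + by exists 0, false.
  + by exists 0, true.
- case=> [|n] c /=; last exact: label_src L _ _.
  by rewrite /decl_src (label_ty0 L).
- case=> [|n] c /=; last exact: label_tgt L _ _.
  by rewrite /decl_tgt (label_ty0 L).
- by case.
Qed.

(** Hides the removal of [pt1 Y] in dimension 0, so that all dimensions split alike. *)
Lemma wedge_cellP (X Y : bigset) n (c : wedge X Y n) :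
  (exists x : X n, c = wedge_inl Y x) \/ (exists y : Y n, c = wedge_inr X y).
Proof.
case: n c => [|n] [x|y]; first by left; exists x.
- right; exists (val y); rewrite /= /wedge_inr0.
  by rewrite (insubT (fun y => y != pt1 Y) (valP y)) /=; congr inr; exact: val_inj.
- by left; exists x.
- by right; exists y.
Qed.

Definition wedge_label (X Y : bigset) (l : label X) (l' : label Y) :
    label (wedge X Y) := fun n =>
  match n return wedge X Y n -> var * ty with
  | 0 => fun c => match c with inl x => l 0 x | inr y => l' 0 (val y) end
  | m.+1 => fun c => match c with inl x => l m.+1 x | inr y => l' m.+1 y end
  end.

Lemma wedge_label_inl (X Y : bigset) (l : label X) (l' : label Y) n (x : X n) :
  wedge_label l l' (wedge_inl Y x) = l n x.
Proof. by case: n x. Qed.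

Lemma wedge_label_inr (X Y : bigset) (l : label X) (l' : label Y) n (y : Y n) :
  l 0 (pt2 X) = l' 0 (pt1 Y) -> wedge_label l l' (wedge_inr X y) = l' n y.
Proof.
move=> e; case: n y => [|n] //= y; rewrite /wedge_inr0.
by case: insubP => [u _ -> //|]; rewrite negbK => /eqP ->.
Qed.

Lemma wedge_labelling (X Y : bigset) (G H : pred (var * ty)) A x y z
    (l : label X) (l' : label Y) :
  (forall r, G r -> H r -> r = (y, A)) ->
  labelling G A x y l -> labelling H A y z l' ->
  labelling (predU G H) A x z (wedge_label l l').
Proof.
move=> GH L M.
have e : l 0 (pt2 X) = l' 0 (pt1 Y) by rewrite (label_pt2 L) (label_pt1 M).
have meet n (c : X n) (d : Y n) : l n c = l' n d -> l' n d = (y, A).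
  by move=> cd; apply: GH; [rewrite -cd; exact: label_mem L _ _|exact: label_mem M _ _].
(* The only shared declaration is (y, A), which names a 0-cell. *)
have meetS n (c : X n.+1) (d : Y n.+1) : l _ c = l' _ d -> False.
  move=> cd; have := label_depth M d; rewrite (meet _ _ _ cd) /=; lia.
split.
- case=> [|n] [c|c] [d|d] //= cd.
  + by congr inl; exact: label_inj L _ _ _ cd.
  + have := meet _ _ _ cd; rewrite -(label_pt1 M) => /(label_inj M) ed.
    by have := valP d; rewrite /= ed eqxx.
  + have := meet _ _ _ (esym cd); rewrite -(label_pt1 M) => /(label_inj M) ec.
    by have := valP c; rewrite /= ec eqxx.
  + by congr inr; apply: val_inj; exact: label_inj M _ _ _ cd.
  + by congr inl; exact: label_inj L _ _ _ cd.
  + by case: (meetS _ _ _ cd).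
  + by case: (meetS _ _ _ (esym cd)).
  + by congr inr; exact: label_inj M _ _ _ cd.
- move=> n c; case: (wedge_cellP c) => -[d ->] /=.
    by rewrite wedge_label_inl (label_mem L).
  by rewrite wedge_label_inr // (label_mem M) orbT.
- move=> n c; case: (wedge_cellP c) => -[d ->].
    by rewrite wedge_label_inl (label_depth L).
  by rewrite wedge_label_inr // (label_depth M).
- move=> r /orP [/(label_surj L)|/(label_surj M)] [n [c <-]].
    by exists n, (wedge_inl Y c); rewrite wedge_label_inl.
  by exists n, (wedge_inr X c); rewrite wedge_label_inr.
- move=> n [c|c] /=; first by rewrite wedge_label_inl (label_src L).
  by rewrite wedge_label_inr // (label_src M).
- move=> n [c|c] /=; first by rewrite wedge_label_inl (label_tgt L).
  by rewrite wedge_label_inr // (label_tgt M).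
- move=> c; case: (wedge_cellP c) => -[d ->].
    by rewrite wedge_label_inl (label_ty0 L).
  by rewrite wedge_label_inr // (label_ty0 M).
- by rewrite wedge_label_inl (label_pt1 L).
- by rewrite wedge_label_inr // (label_pt2 M).
Qed.

Lemma labelling_eq (X : bigset) (G H : pred (var * ty)) A x y (l : label X) :
  G =1 H -> labelling G A x y l -> labelling H A x y l.
Proof. by move=> /funext ->. Qed.

Lemma fresh_var (s : seq nat) : exists y, y \notin s.
Proof.
exists (\max_(i <- s) i).+1; apply/negP => yS.
have := leq_bigmax_seq (P := predT) (F := id) _ yS isT.
by rewrite ltnn.
Qed.

(** The first branch is opened by [pse] and its subtree is built over f; the remaining branches are
    built over y. *)
Lemma psv_extend B Γ x A (d : psv Γ x A) : exists Γ' x' (l : label (Pos B)),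
  [/\ inhabited (psv (Γ' ++ Γ) x' A), rev (dims Γ') = tree_dims (ty_depth A) B
    & labelling (mem ((x, A) :: Γ')) A x x' l].
Proof.
elim/Bat_nested_ind: B Γ x A d => [|B Bs IHB IHBs] Γ x A d.
  exists [::], x; have [l L] := D0_labelling A x; exists l; split=> //.
  by apply: labelling_eq L => r; rewrite /= inE.
have [y yΓ] := fresh_var (Var Γ).
have [f] := fresh_var (y :: Var Γ); rewrite inE negb_or eq_sym => /andP [yf fΓ].
have [Γ1 [f' [l1 [[d1] e1 L1]]]] := IHB _ _ _ (pse d yΓ fΓ yf).
(* [f'] is parallel to f, so its target is still y and [psd] returns to y : A. *)
have [Γ2 [x' [l2 [[d2] e2 L2]]]] := IHBs _ _ _ (psd d1).
have xΓ : (x, A) \in Γ by case: (psv_mem d).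
have xy : x != y by apply: contraNneq yΓ => <-; exact: (map_f fst xΓ).
have [l1' L1'] := susp_labelling xy L1.
exists (Γ2 ++ Γ1 ++ [:: (f, Arr x A y); (y, A)]), x', (wedge_label l1' l2); split.
- by split; rewrite -!catA.
- by rewrite /dims !map_cat !rev_cat /= e1 e2.
apply: labelling_eq (wedge_labelling _ L1' L2) => r /=.
  rewrite !inE !mem_cat !inE.
  by case: (_ == _) (_ == _) (_ == _) (r \in Γ1) (r \in Γ2) => [] [] [] [] [].
(* A shared declaration other than y would occur both in [Γ2] and in the context it extends, against
   distinctness of variables. *)
move=> G1 /orP [/eqP //|r2].
have := psv_uniq d2; rewrite /Var map_cat cat_uniq => /and3P [_ /hasPn u _].
have r2' : r.1 \in [seq p.1 | p <- Γ2] := map_f fst (r2 : r \in Γ2).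
exfalso; apply: negP r2'; apply: u.
rewrite map_cat mem_cat /= !inE.
case/orP: G1; rewrite ?inE => /orP [/eqP ->|r1] /=; rewrite ?eqxx ?orbT //.
- by rewrite (map_f fst (r1 : r \in Γ1)).
- by rewrite (map_f fst xΓ) !orbT.
- by rewrite (eqP r1) eqxx !orbT.
Qed.

(** * From labellings to isomorphisms and the bijection *)

Definition decl_ren (σ : var -> var) (p : var * ty) := (σ p.1, ty_ren σ p.2).

Lemma decl_ren_src σ p : decl_ren σ (decl_src p) = decl_src (decl_ren σ p).
Proof. by case: p => x []. Qed.

Lemma decl_ren_tgt σ p : decl_ren σ (decl_tgt p) = decl_tgt (decl_ren σ p).
Proof. by case: p => x []. Qed.

Lemma labelling_ren (X : bigset) (Γ Δ : pctx) A x x' (l : label X) σ :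
  labelling (mem (ctx_of Γ)) A x x' l -> renaming σ Γ Δ ->
  labelling (mem (ctx_of Δ)) (ty_ren σ A) (σ x) (σ x') (fun n c => decl_ren σ (l n c)).
Proof.
move=> L [σI eΔ].
have lV n c : (l n c).1 \in Var Γ by apply: map_f; exact: label_mem L n c.
split=> /=.
- move=> n c d [/σI] /(_ (lV _ _) (lV _ _)) e _; apply: (label_inj L).
  by apply: decl_var_inj e; exact: label_mem L _ _.
- by move=> n c; rewrite eΔ; apply: (map_f (decl_ren σ)); exact: label_mem L _ _.
- by move=> n c; rewrite !ty_depth_ren (label_depth L).
- move=> r; rewrite eΔ => /mapP [p /(label_surj L) [n [c <-]] ->].
  by exists n, c.
- by move=> n c; rewrite (label_src L) decl_ren_src.
- by move=> n c; rewrite (label_tgt L) decl_ren_tgt.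
- by move=> c; rewrite (label_ty0 L).
- by rewrite (label_pt1 L).
- by rewrite (label_pt2 L).
Qed.

(** Over [Star] the depth of a label is the dimension of its cell, so each n-cell of [V Γ] is named
    by an n-cell of X. *)
Lemma labelling_giso (X : bigset) (Γ : pctx) x x' (l : label X) :
  labelling (mem (ctx_of Γ)) Star x x' l ->
  exists φ : giso (V Γ) X, forall n v, l n (φ n v) = val v.
Proof.
move=> L.
have fwd n (v : V Γ n) : {c : X n | l n c = val v}.
  apply: cid; case: v => p /= /andP [/(label_surj L) [m [c <-]] dp].
  have := label_depth L c; rewrite ty_dimE in dp => /= em.
  by have e : m = n by [lia]; case: _ / e; exists c.
pose φ n v := sval (fwd n v).
have φE n v : l n (φ n v) = val v := svalP (fwd n v).
have lV n (c : X n) :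
    (l n c \in ctx_of Γ) && (ty_dim (l n c).2 + 1 == Posz n)%R.
  by rewrite ty_dimE (label_depth L) eqxx andbT; exact: label_mem L _ _.
pose ψ n c : V Γ n := exist _ (l n c) (lV n c).
have φs n (v : V Γ n.+1) : φ _ (src v) = src (φ _ v).
  by apply: (label_inj L); rewrite (label_src L) !φE.
have φt n (v : V Γ n.+1) : φ _ (tgt v) = tgt (φ _ v).
  by apply: (label_inj L); rewrite (label_tgt L) !φE.
have ψs n (c : X n.+1) : ψ _ (src c) = src (ψ _ c).
  by apply: val_inj; rewrite /= (label_src L).
have ψt n (c : X n.+1) : ψ _ (tgt c) = tgt (ψ _ c).
  by apply: val_inj; rewrite /= (label_tgt L).
have φK n : cancel (@φ n) (@ψ n) by move=> v; apply: val_inj; exact: φE.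
have ψK n : cancel (@ψ n) (@φ n) by move=> c; apply: (label_inj L); rewrite φE.
by exists (@GIso _ _ (GMap φs φt) (GMap ψs ψt) φK ψK).
Qed.

Lemma canonical_ctx_exists B : exists (Γ : pctx) (l : label (Pos B)),
  rev (dims Γ) = 0 :: tree_dims 0 B /\
  exists x x', labelling (mem (ctx_of Γ)) Star x x' l.
Proof.
have [Γ [x' [l [[d] e L]]]] := psv_extend B (pss 0).
exists (PCtx (ps_intro d)), l; split=> /=.
  by rewrite /dims map_cat rev_cat /= e.
exists 0, x'; apply: labelling_eq L => r /=.
by rewrite mem_cat !inE orbC.
Qed.

Definition canonical_ctx B : pctx := sval (cid (canonical_ctx_exists B)).

Definition canonical_label B : label (Pos B) :=
  sval (cid (svalP (cid (canonical_ctx_exists B)))).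

Lemma canonical_ctxP B : rev (dims (canonical_ctx B)) = 0 :: tree_dims 0 B /\
  exists x x', labelling (mem (ctx_of (canonical_ctx B))) Star x x' (@canonical_label B).
Proof. exact: svalP (cid (svalP (cid (canonical_ctx_exists B)))). Qed.

Lemma canonical_ctx_inj B B' :
  dims (canonical_ctx B) = dims (canonical_ctx B') -> B = B'.
Proof.
have [e _] := canonical_ctxP B; have [e' _] := canonical_ctxP B'.
by move=> eB; apply: tree_dims_inj; move: e'; rewrite -eB e => -[].
Qed.

Lemma PsCtx_tree (c : PsCtx) : exists B, sval c = ren_class (canonical_ctx B).
Proof.
case: c => c [Γ eΓ] /=; rewrite {c}eΓ; case: (ps_of Γ) => x /psv_tree [B eB _].
exists B; have [e _] := canonical_ctxP B.
have {}eB : dims Γ = dims (canonical_ctx B) by apply: (can_inj revK); rewrite e eB.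
by apply/funext => Δ; apply/propext; split=> /renamingP h; apply/renamingP;
  rewrite -h ?eB.
Qed.

Definition tree_of (c : PsCtx) : Bat := sval (cid (PsCtx_tree c)).

Lemma tree_ofP c : sval c = ren_class (canonical_ctx (tree_of c)).
Proof. exact: svalP (cid (PsCtx_tree c)). Qed.

Lemma tree_of_bij : bijective tree_of.
Proof.
pose cls B : PsCtx := exist _ (ren_class (canonical_ctx B)) (ex_intro _ _ (erefl _)).
exists cls => [c|B].
  by apply: eq_sig_hprop => [? ? ?|]; [exact: Prop_irrelevance|rewrite /= -tree_ofP].
apply: canonical_ctx_inj; apply/renamingP.
have : represents (canonical_ctx B) (cls B) by apply/renamingP.
by rewrite /represents tree_ofP.
Qed.

(** The renaming [σ] is recorded because it allows the isomorphisms of two representatives to be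
    compared. *)
Lemma represents_giso (c : PsCtx) (Γ : pctx) : represents Γ c ->
  exists (φ : giso (V Γ) (Pos (tree_of c))) (σ : var -> var),
    renaming σ (canonical_ctx (tree_of c)) Γ /\
    forall n v, decl_ren σ (canonical_label (φ n v)) = val v.
Proof.
rewrite /represents tree_ofP => -[σ rσ].
have [_ [x [x' L]]] := canonical_ctxP (tree_of c).
by have [φ φE] := labelling_giso (labelling_ren L rσ); exists φ, σ.
Qed.

(** * Intrinsic description of the boundaries *)

Definition opp_end (X : globSet) (e : sign) n : X n.+1 -> X n :=
  if e is minus then @tgt X n else @src X n.

(* A k-cell is missing from the k-th source exactly when it is a target, hence
   the reversal in [opp_end]. *)
Definition in_bd (X : globSet) (e : sign) (k n : nat) (x : X n) : Prop :=
  n < k \/ n = k /\ forall y : X n.+1, opp_end e y <> x.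

Lemma in_bd_giso (X Y : globSet) (φ : giso X Y) e k n (x : X n) :
  in_bd e k (φ n x) <-> in_bd e k x.
Proof.
have oppE (Z W : globSet) (ψ : gmap Z W) m (y : Z m.+1) :
    opp_end e (ψ _ y) = ψ _ (opp_end e y).
  by case: e; rewrite /= ?gmap_src ?gmap_tgt.
split=> -[|[nk h]]; try (by left); right; split=> // y yx.
  by apply: (h (φ _ y)); rewrite oppE yx.
by apply: (h (giso_inv φ _ y)); rewrite oppE yx giso_K.
Qed.

Definition decl_end (e : sign) : var * ty -> var * ty :=
  if e is minus then decl_tgt else decl_src.

(** The guard excludes type [Star], where [decl_src] and [decl_tgt] return junk. *)
Definition is_end (e : sign) (Γ : ctx) (r : var * ty) : bool :=
  has (fun p => (0 < ty_depth p.2) && (decl_end e p == r)) Γ.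

Arguments is_end : simpl never.

Lemma is_end_mem e Γ x A (d : psv Γ x A) r : is_end e Γ r -> r \in Γ.
Proof.
have [_ cl] := psv_mem d.
case/hasP=> -[z [//|u B v]] zΓ /= /eqP <-.
by case: e; case: (cl _ _ _ _ zΓ).
Qed.

Lemma psv_last_head D z A : psv_last D z A -> exists D', D = (z, A) :: D'.
Proof. by case=> [->|D' u B v _ _ _ _ ->]; eexists. Qed.

(** Under [pse], f makes y a target and x a source. At dimension k the source boundary accordingly
    omits y, and the target boundary replaces x by y. *)
Lemma psv_bd_mem e k Γ x A (d : psv Γ x A) r :
  (r \in psv_bd e k d) = (r \in Γ) &&
    ((ty_depth r.2 < k) || (ty_depth r.2 == k) && ~~ is_end e Γ r).
Proof.
elim: d => {Γ x A} [x|Γ f x A y d IH|Γ x A y f d IH yΓ fΓ yf] //=.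
  by rewrite inE; case: eqP => //= -> /=; case: k.
have -> : (Posz k < ty_dim A + 1)%R = (k < ty_depth A) by rewrite ty_dimE; lia.
have -> : (ty_dim A + 1 <= Posz k - 1)%R = (ty_depth A < k) by rewrite ty_dimE; lia.
have [xΓ _] := psv_mem d.
have yN : (y, A) \notin Γ by apply: contra yΓ; exact: (map_f fst).
have fN B : (f, B) \notin Γ by apply: contra fΓ; exact: (map_f fst).
(* The ends of y are already ends of x, which has the same type; only f can add one. *)
have endE : is_end e ((f, Arr x A y) :: (y, A) :: Γ) r =
    (r == decl_end e (f, Arr x A y)) || is_end e Γ r.
  rewrite /is_end /= eq_sym; congr (_ || _); apply/orb_idl => /andP [A0 h].
  apply/hasP; exists (x, A) => //=; rewrite A0 /=.
  by move: h; case: (e); case: (A) A0.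
(* At dimension k the target boundary ends with x, so [behead] removes exactly x. *)
have XE : e = plus -> ty_depth A = k ->
    (r \in behead (psv_bd e k d)) = (r != (x, A)) && (r \in psv_bd e k d).
  move=> -> Ak; have [l _] := psv_bd_plus k d.
  have {l} : psv_last (psv_bd plus k d) (ktgt k x A).1 (ktgt k x A).2.
    by apply: l; rewrite ty_dimE Ak.
  rewrite ktgt_small ?ty_dimE ?Ak //= => l.
  have [t tE] := psv_last_head l.
  have := psv_uniq (psv_last_psv l); rewrite tE /= => /andP [xt _].
  rewrite inE; case: eqVneq => //= ->; apply/negbTE.
  by apply: contra xt; exact: (map_f fst).
have notin p : p \notin Γ -> (is_end e Γ p = false) * (p \in Γ = false).
  by move=> /negbTE pN; split=> //; apply/negP => /(is_end_mem d); rewrite pN.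
have YX : (y, A) == (x, A) = false by apply: contraNF yN => /eqP ->.
have FY : (f, Arr x A y) == (y, A) = false by apply: contraNF yf => /eqP [->].
have FX : (f, Arr x A y) == (x, A) = false.
  by apply: contraNF (fN (Arr x A y)) => /eqP ->.
have FE : (f, Arr x A y) == decl_end e (f, Arr x A y) = false by case: (e).
rewrite endE !inE.
have big h : k <= h -> (h.+1 < k = false) * (h.+1 == k = false).
  by move=> kh; rewrite gtn_eqF // ltnNge (leq_trans kh).
have [rF|rF] := eqVneq r (f, Arr x A y).
  rewrite rF in IH XE *; rewrite !(notin _ (fN _)) /= in IH *.
  rewrite FE; case: (ltngtP (ty_depth A) k) XE => hk XE.
  - by rewrite inE eqxx /= andbT orbC -leq_eqVlt.
  - by rewrite IH !big // ltnW.
  - rewrite !big ?hk //.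
    by case: (e) IH XE => /= IH XE; rewrite ?inE ?FY ?IH ?XE ?IH ?andbF.
have [rY|rY] := eqVneq r (y, A).
  rewrite rY in IH XE *; rewrite !(notin _ yN) /= in IH *.
  case: (ltngtP (ty_depth A) k) XE => hk XE; rewrite ?inE ?eqxx ?orbT ?IH //.
  by case: (e) IH XE => /= IH XE; rewrite ?inE ?eqxx ?IH ?YX.
(* Among older declarations f adds only the end x, for [plus]; this matters only at depth k. *)
case: (ltngtP (ty_depth A) k) XE => hk XE; rewrite ?inE ?(negbTE rF) ?(negbTE rY) /= ?IH.
- case: (e) => /=; rewrite ?(negbTE rY) //=.
  by case: (eqVneq r (x, A)) => [->|_] //=; rewrite xΓ /= hk.
- case: (e) => /=; rewrite ?(negbTE rY) //=.
  by case: (eqVneq r (x, A)) => [->|_] //=; rewrite xΓ /= gtn_eqF ?andbF ?orbF // ltnNge ltnW.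
case: (e) IH XE => /= IH XE; first by rewrite (negbTE rY) IH.
rewrite inE (negbTE rY) /= XE // IH -[decl_src _]/(x, A).
by case: (eqVneq r (x, A)) => [->|_] //=; rewrite xΓ /= hk ltnn andbF.
Qed.

(** * Boundaries of positions *)

Lemma wedge_inl_inj (X Y : bigset) n : injective (@wedge_inl X Y n).
Proof. by case: n => [|n] x y []. Qed.

Lemma wedge_inl_inr (X Y : bigset) (x : X 0) (y : Y 0) :
  wedge_inl Y x = wedge_inr X y -> x = pt2 X /\ y = pt1 Y.
Proof.
rewrite /= /wedge_inr0; case: insubP => /= [u _ _ //|]; rewrite negbK => /eqP -> [->].
by split.
Qed.

Lemma wedge_glue (X Y : bigset) : wedge_inl Y (pt2 X) = wedge_inr X (pt1 Y).
Proof. by rewrite /= /wedge_inr0 insubF // eqxx. Qed.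

Lemma wedge_inr_inj (X Y : bigset) n : injective (@wedge_inr X Y n).
Proof.
case: n => [|n] x y; last by case.
have [->|nx] := eqVneq x (pt1 Y).
  by rewrite -wedge_glue => /wedge_inl_inr [].
rewrite /= /wedge_inr0 (insubT (fun y => y != pt1 Y) nx).
by case: insubP => // u _ <- [<-].
Qed.

Definition free_end (e : sign) (X : bigset) : Prop :=
  forall x : X 0, (forall y : X 1, opp_end e y <> x) <->
    x = if e is minus then pt1 X else pt2 X.

(** The cell x becomes a 1-cell from v_- to v_+, which leaves only one of them free. *)
Lemma susp_free_end e (X : globSet) (x : X 0) : free_end e (susp X).
Proof.
case: e => -[] /=; split=> //.
- by move=> /(_ x).
- by move=> /(_ x).
Qed.

(** A free cell is free in each summand containing it. For [minus], one coming from Y is the glued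
    point, which must then be free in X too; [plus] is dual. *)
Lemma wedge_free_end e (X Y : bigset) :
  free_end e X -> free_end e Y -> free_end e (wedge X Y).
Proof.
move=> fX fY c.
have inlN (x : X 0) : (forall z : wedge X Y 1, opp_end e z <> wedge_inl Y x) ->
    forall z : X 1, opp_end e z <> x.
  move=> h z zx; case: e {fX fY} zx h => zx h; case: (h (inl z));
  by rewrite /opp_end -zx.
have inrN (y : Y 0) : (forall z : wedge X Y 1, opp_end e z <> wedge_inr X y) ->
    forall z : Y 1, opp_end e z <> y.
  move=> h z zy; case: e {fX fY inlN} zy h => zy h; case: (h (inr z));
  by rewrite /opp_end -zy.
case: e fX fY inlN inrN => fX fY inlN inrN; split.
- case: (wedge_cellP c) => -[x ->]; first by move=> /inlN /fX ->.
  move=> h; have x1 : x = pt1 Y by apply/fY; exact: inrN.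
  by move: h; rewrite x1 -wedge_glue => /inlN /fX ->.
- move=> -> [x|y].
    by move=> /wedge_inl_inj; exact: (fX _).2.
  by move=> /esym /wedge_inl_inr [_]; exact: (fY _).2.
- case: (wedge_cellP c) => -[x ->]; last by move=> /inrN /fY ->.
  move=> h; have x2 : x = pt2 X by apply/fX; exact: inlN.
  by move: h; rewrite x2 wedge_glue => /inrN /fY ->.
- move=> -> [x|y].
    by move=> /wedge_inl_inr [+ _]; exact: (fX _).2.
  by move=> /wedge_inr_inj; exact: (fY _).2.
Qed.

Lemma Pos_free_end e B : free_end e (Pos B).
Proof.
elim/Bat_nested_ind: B => [|B Bs _ IHBs].
  by case: e; case; split.
apply: wedge_free_end => //; exact/susp_free_end/(pt1 (Pos B)).
Qed.

Definition pos_bd (e : sign) (k : nat) : forall B, gmap (Pos (bat_bd k B)) (Pos B) :=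
  if e is minus then pos_s k else pos_t k.

Lemma pos_bd_br e k Bs :
  pos_bd e k.+1 (br Bs) = bigwedge_susp_map (pos_bd e k) Bs.
Proof. by case: e. Qed.

Local Open Scope classical_set_scope.

(** For k = 0 this is [Pos_free_end]. For k+1 every 0-cell is in the range, and in positive
    dimension the wedge is a disjoint union, so each branch is treated alone, with suspension
    shifting the dimension. *)
Lemma range_pos_bd e k B n (x : Pos B n) :
  range (pos_bd e k B n) x <-> in_bd e k x.
Proof.
elim: k B n x => [|k IH] [Bs] n x.
  have f := @Pos_free_end e (br Bs).
  have pE : pos_bd e 0 (br Bs) =
      D0_map (if e is minus then pt1 (Pos (br Bs)) else pt2 (Pos (br Bs))).
    by case: (e).
  rewrite pE; split.
    move=> [u _ <-]; case: n {x} u => [|n] [] /=; right; split=> //.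
    exact/f.
  move=> [//|[n0 h]]; case: _ / (esym n0) x h.
  move=> x /f ->; by exists tt.
rewrite pos_bd_br.
elim: Bs n x => [|B Bs IHBs] n x.
  split=> [_|_]; last by exists x.
  by case: n x => [|n] []; left.
case: n x => [|n] x.
  split=> [_|_]; first by left.
  case: (wedge_cellP x) => -[y ->]; first by exists (wedge_inl _ y).
  have [w _ <-] : range (bigwedge_susp_map (pos_bd e k) Bs 0) y by apply/IHBs; left.
  exists (wedge_inr _ w) => //; exact: wedge_fun_inr.
case: x => x.
  apply: (@iff_trans _ (range (pos_bd e k B n) x)).
    split; last by move=> [w _ <-]; exists (inl w).
    by move=> [[w|w] _ //= [<-]]; exists w.
  rewrite IH; split=> -[h|[nk h]]; try (by left); right; split; try lia.
    by case=> y; case: e h {IH IHBs} => h /= [] //; exact: h.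
  move=> y yx; apply: (h (inl y)); case: e yx {h IH IHBs} => yx /=; rewrite -yx //.
apply: (@iff_trans _ (range (bigwedge_susp_map (pos_bd e k) Bs n.+1) x)).
  split; last by move=> [w _ <-]; exists (inr w).
  by move=> [[w|w] _ //= [<-]]; exists w.
rewrite IHBs; split=> -[h|[nk h]]; try (by left); right; split=> //.
  by case=> y; case: e h {IH IHBs} => h /= [] //; exact: h.
move=> y yx; apply: (h (inr y)); case: e yx {h IH IHBs} => yx /=; rewrite -yx //.
Qed.

(** * Boundaries of contexts, and conclusion *)

Lemma range_V_bd e k (Γ : pctx) n (v : V Γ n) :
  range (V_bd e k Γ n) v <-> in_bd e k v.
Proof.
have vd : ty_depth (val v).2 = n.
  by case: v => p /= /andP [_]; rewrite ty_dimE => /eqP [].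
have vΓ : val v \in ctx_of Γ by case: v {vd} => p /= /andP [].
have -> : range (V_bd e k Γ n) v <-> val v \in ctx_of (pctx_bd e k Γ).
  split=> [[w _ <-]|h]; first by case: w => p /= /andP [].
  have wP : (val v \in ctx_of (pctx_bd e k Γ)) && (ty_dim (val v).2 + 1 == Posz n)%R.
    by rewrite h ty_dimE vd eqxx.
  by exists (exist _ (val v) wP) => //; exact: val_inj.
have -> : (val v \in ctx_of (pctx_bd e k Γ)) =
    ((n < k) || (n == k) && ~~ is_end e Γ (val v)).
  rewrite /= /ps_bd; move: vΓ; case: (ps_of Γ) => x d.
  by rewrite psv_bd_mem vd => ->.
(* A declaration with end v is one dimension above v, hence an (n+1)-cell. *)
have endP : is_end e Γ (val v) <-> exists w : V Γ n.+1, opp_end e w = v.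
  split=> [/hasP [p pΓ /andP [p0 /eqP pv]]|[w wv]].
    have wP : (p \in ctx_of Γ) && (ty_dim p.2 + 1 == Posz n.+1)%R.
      rewrite pΓ ty_dimE; apply/eqP; congr Posz; rewrite -vd -pv.
      by case: p p0 {pΓ pv} => z [//|u B w] _; case: (e).
    by exists (exist _ p wP); apply: val_inj; rewrite -pv; case: (e).
  apply/hasP; exists (val w); first by case: (w) => p /= /andP [].
  rewrite -wv; case: (w) => p pP /=; apply/andP; split.
    by move: pP => /andP [_]; rewrite ty_dimE => /eqP [] ->.
  by case: (e).
split.
  case/orP=> [nk|/andP [/eqP nk N]]; [by left|right; split=> // y yv].
  by move/negP: N; apply; apply/endP; exists y.
case=> [-> //|[/eqP nk N]]; apply/orP; right; rewrite nk; apply/negP => /endP [w].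
exact: N.
Qed.

Theorem theorem5p5 :
  exists B : PsCtx -> Bat, bijective B /\
  exists R : forall (c : PsCtx) (Γ : pctx), represents Γ c ->
               giso (V Γ) (Pos (B c)),
    (* R is a family over PsCtx: it does not depend on the names *)
    (forall (c : PsCtx) (Γ Δ : pctx) (hΓ : represents Γ c)
        (hΔ : represents Δ c) (σ : var -> var), renaming σ Γ Δ ->
      forall (n : nat) (x : V Γ n) (y : V Δ n),
        cell_var y = σ (cell_var x) -> R c Δ hΔ n y = R c Γ hΓ n x) /\
    (forall (c : PsCtx) (Γ : pctx) (hΓ : represents Γ c),
      (1 <= ctx_dim Γ)%R ->
      let k := `|ctx_dim Γ - 1|%N in
      forall n : nat,
        (R c Γ hΓ n @` range (V_s k Γ n) = range (pos_s k (B c) n))%classic /\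
        (R c Γ hΓ n @` range (V_t k Γ n) = range (pos_t k (B c) n))%classic).
Proof.
exists tree_of; split; first exact: tree_of_bij.
exists (fun c Γ h => sval (cid (represents_giso h))); split.
  move=> c Γ Δ hΓ hΔ τ [τI eΔ] n x y eyx.
  case: cid => ψ /= [ρ [rρ ψE]]; case: cid => φ /= [σ [[_ eσ] φE]].
  have [_ eρ] := rρ.
  set C := canonical_ctx (tree_of c) in eσ eρ.
  have [_ [a [b L]]] := canonical_ctxP (tree_of c).
  (* Both [ρ] and [τ] after [σ] carry [C] to Δ as lists, so they agree on each entry. *)
  have ρE (p : var * ty) : p \in ctx_of C -> decl_ren ρ p = decl_ren τ (decl_ren σ p).
    move: p; apply/eq_in_map; rewrite -/(ctx_ren ρ C) -eρ eΔ eσ.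
    by rewrite /ctx_ren -map_comp.
  have yE : val y = decl_ren τ (val x).
    have yΔ : val y \in ctx_of Δ by case: (y) => p /= /andP [].
    have xΓ : val x \in ctx_of Γ by case: (x) => p /= /andP [].
    apply: (decl_var_inj yΔ); last exact: eyx.
    by rewrite eΔ; exact: (map_f (decl_ren τ) xΓ).
  (* Cells are compared through their labels in Δ. *)
  apply: (label_inj (labelling_ren L rρ)) => /=.
  rewrite ψE ρE; last exact: label_mem L _ _.
  by rewrite φE.
move=> c Γ hΓ _ k n; case: cid => φ /= _.
suff img e : [set φ n v | v in range (V_bd e k Γ n)] = range (pos_bd e k (tree_of c) n).
  by split; [exact: (img minus)|exact: (img plus)].
apply/seteqP; split=> x.
  by move=> [v /range_V_bd vb <-]; apply/range_pos_bd/in_bd_giso.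
move=> /range_pos_bd xb; exists (giso_inv φ n x); last exact: giso_VK.
by apply/range_V_bd; apply/(in_bd_giso φ); rewrite giso_VK.
Qed.
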